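(* Let $\sigma$ and $\sigma'=\exists y\,(\mathsf{wb}(y)\wedge\sigma_0'(y))$ be 1-$\Sigma_1$-sentences and let $\rho$ be a $\Sigma_1$-sentence. Then: (a) if $\mathbb{N}\models\sigma\leq\sigma'$ and $\mathsf{R}_0\vdash\rho\leftrightarrow(\sigma'<\sigma)$, then $[\rho]$ is inconsistent; (b) if $\mathbb{N}\models\sigma<\sigma'$ and $\mathsf{R}_0\vdash\rho\leftrightarrow(\sigma'\leq\sigma)$, then $[\rho]$ is inconsistent.
   Context: $\mathbb{L}_{\sf a}=\{0,\mathsf{S},+,\times,\leq\}$ with $\leq$ primitive; $x<y$ abbreviates $x\leq y\wedge x\neq y$; $\overline{n}$ are numerals. $\mathsf{R}_0$ has axioms, for all $m,n\in\omega$: $\overline{m}+\overline{n}=\overline{m+n}$; $\overline{m}\times\overline{n}=\overline{m\times n}$; $\overline{m}\neq\overline{n}$ if $m\neq n$; $\forall x\,(x\leq\overline{n}\to\bigvee_{i\leq n}x=\overline{i})$; $\overline{m}\leq\overline{n}$ if $m\leq n$. A ($1$-)$\Sigma_1$-sentence is $\exists\vec x\,\delta$ (resp. $\exists x\,\delta(x)$) with $\delta$ bounded. $\mathsf{wb}(x)$ is $0\leq x\wedge\forall y<x\;\mathsf{S}y\leq x$. For $\varphi=\exists x\,\varphi_0(x)$, $\psi=\exists y\,\psi_0(y)$: $\varphi\leq\psi:=\exists x(\varphi_0(x)\wedge\forall y<x\,\neg\psi_0(y))$, $\varphi<\psi:=\exists x(\varphi_0(x)\wedge\forall y\leq x\,\neg\psi_0(y))$.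 A pure $\Delta_0$-formula is a bounded formula whose atomic $\leq$-formulas relate two variables and whose atomic equations have the forms $x_0=x_1$, $0=x_0$, $\mathsf{S}x_0=x_1$, $x_0+x_1=x_2$, $x_0\times x_1=x_2$. For the $\Sigma_1$-sentence $\rho$, $\rho^\bullet=\exists x\,\rho_0(x)$ is a pure 1-$\Sigma_1$-sentence (with $\rho_0$ pure $\Delta_0$), found effectively, with $\mathbb{N}\models\rho\leftrightarrow\rho^\bullet$ and $\rho^\bullet\to\rho$ logically valid; then $[\rho]:=\exists x\,(\mathsf{cert}(x)\wedge\rho_0(x))$, where $\mathsf{cert}(v)$ is the conjunction of: $0\leq v$; $\forall x<v\;\mathsf{S}x\leq v$; $\forall x(x\leq 0\leftrightarrow x=0)$; $\forall x<v\,\forall y(y\leq\mathsf{S}x\leftrightarrow(y\leq x\vee y=\mathsf{S}x))$; $\forall x,y,z\leq v\;\mathsf{S}((x\times y)+z)\neq0$; $\forall x,y,z,w\leq v(\mathsf{S}((x\times y)+z)=\mathsf{S}w\to(x\times y)+z=w)$; $\forall x,y\leq v\;(x\times y)+0=x\times y$; $\forall x,y,z\leq v\;(x\times y)+\mathsf{S}z=\mathsf{S}((x\times y)+z)$; $\forall x\leq v\;x\times0=0$; $\forall x,y\leq v\;x\times\mathsf{S}y=(x\times y)+x$. *)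

(* Defs.v *)
From Stdlib Require Import List Arith.
Import ListNotations.

(** * Syntax of the arithmetical language 0, S, +, *, <= (de Bruijn indices) *)

Inductive term : Type :=
| tVar (n : nat)
| tZero
| tSucc (t : term)
| tAdd (t u : term)
| tMul (t u : term).

Inductive form : Type :=
| fEq (t u : term)
| fLe (t u : term)
| fBot
| fImp (A B : form)
| fAnd (A B : form)
| fOr (A B : form)
| fAll (A : form)
| fEx (A : form).

Definition fNeg (A : form) : form := fImp A fBot.
Definition fIff (A B : form) : form := fAnd (fImp A B) (fImp B A).
Definition fLt (t u : term) : form := fAnd (fLe t u) (fNeg (fEq t u)).

Fixpoint tsubst (s : nat -> term) (t : term) : term :=
  match t with
  | tVar n => s n
  | tZero => tZero
  | tSucc t => tSucc (tsubst s t)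
  | tAdd t u => tAdd (tsubst s t) (tsubst s u)
  | tMul t u => tMul (tsubst s t) (tsubst s u)
  end.

Definition shift : nat -> term := fun n => tVar (S n).

Definition scons (t : term) (s : nat -> term) : nat -> term :=
  fun n => match n with 0 => t | S n => s n end.

Definition up (s : nat -> term) : nat -> term :=
  scons (tVar 0) (fun n => tsubst shift (s n)).

Fixpoint fsubst (s : nat -> term) (A : form) : form :=
  match A with
  | fEq t u => fEq (tsubst s t) (tsubst s u)
  | fLe t u => fLe (tsubst s t) (tsubst s u)
  | fBot => fBot
  | fImp A B => fImp (fsubst s A) (fsubst s B)
  | fAnd A B => fAnd (fsubst s A) (fsubst s B)
  | fOr A B => fOr (fsubst s A) (fsubst s B)
  | fAll A => fAll (fsubst (up s) A)
  | fEx A => fEx (fsubst (up s) A)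
  end.

Definition finst (t : term) (A : form) : form := fsubst (scons t tVar) A.

Fixpoint tvars_below (k : nat) (t : term) : Prop :=
  match t with
  | tVar n => n < k
  | tZero => True
  | tSucc t => tvars_below k t
  | tAdd t u | tMul t u => tvars_below k t /\ tvars_below k u
  end.

Fixpoint free_below (k : nat) (A : form) : Prop :=
  match A with
  | fEq t u | fLe t u => tvars_below k t /\ tvars_below k u
  | fBot => True
  | fImp A B | fAnd A B | fOr A B => free_below k A /\ free_below k B
  | fAll A | fEx A => free_below (S k) A
  end.

Definition sentence (A : form) : Prop := free_below 0 A.

(** The bound [t] lives outside the quantifier, hence the shift. *)
Definition allLe (t : term) (A : form) : form :=
  fAll (fImp (fLe (tVar 0) (tsubst shift t)) A).
Definition allLt (t : term) (A : form) : form :=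
  fAll (fImp (fLt (tVar 0) (tsubst shift t)) A).
Definition exLe (t : term) (A : form) : form :=
  fEx (fAnd (fLe (tVar 0) (tsubst shift t)) A).
Definition exLt (t : term) (A : form) : form :=
  fEx (fAnd (fLt (tVar 0) (tsubst shift t)) A).

(** * Classical natural deduction with equality *)

Inductive Prf : list form -> form -> Prop :=
| Prf_ax G A : In A G -> Prf G A
| Prf_raa G A : Prf (fNeg A :: G) fBot -> Prf G A
| Prf_impI G A B : Prf (A :: G) B -> Prf G (fImp A B)
| Prf_impE G A B : Prf G (fImp A B) -> Prf G A -> Prf G B
| Prf_andI G A B : Prf G A -> Prf G B -> Prf G (fAnd A B)
| Prf_andE1 G A B : Prf G (fAnd A B) -> Prf G A
| Prf_andE2 G A B : Prf G (fAnd A B) -> Prf G B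
| Prf_orI1 G A B : Prf G A -> Prf G (fOr A B)
| Prf_orI2 G A B : Prf G B -> Prf G (fOr A B)
| Prf_orE G A B C :
    Prf G (fOr A B) -> Prf (A :: G) C -> Prf (B :: G) C -> Prf G C
| Prf_allI G A : Prf (map (fsubst shift) G) A -> Prf G (fAll A)
| Prf_allE G A t : Prf G (fAll A) -> Prf G (finst t A)
| Prf_exI G A t : Prf G (finst t A) -> Prf G (fEx A)
| Prf_exE G A C :
    Prf G (fEx A) -> Prf (A :: map (fsubst shift) G) (fsubst shift C) ->
    Prf G C
| Prf_eqI G t : Prf G (fEq t t)
| Prf_eqE G A t u : Prf G (fEq t u) -> Prf G (finst t A) -> Prf G (finst u A).

Definition theory := form -> Prop.

Definition proves (T : theory) (A : form) : Prop :=
  exists G, Forall T G /\ Prf G A.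

Definition inconsistent (A : form) : Prop := Prf [A] fBot.

(** * Tarskian semantics *)

Record structure : Type := {
  dom : Type;
  i_zero : dom;
  i_succ : dom -> dom;
  i_add : dom -> dom -> dom;
  i_mul : dom -> dom -> dom;
  i_le : dom -> dom -> Prop
}.

Fixpoint eval (M : structure) (e : nat -> dom M) (t : term) : dom M :=
  match t with
  | tVar n => e n
  | tZero => i_zero M
  | tSucc t => i_succ M (eval M e t)
  | tAdd t u => i_add M (eval M e t) (eval M e u)
  | tMul t u => i_mul M (eval M e t) (eval M e u)
  end.

Definition env_cons {D : Type} (d : D) (e : nat -> D) : nat -> D :=
  fun n => match n with 0 => d | S n => e n end.

Fixpoint sat (M : structure) (e : nat -> dom M) (A : form) : Prop :=
  match A with
  | fEq t u => eval M e t = eval M e u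
  | fLe t u => i_le M (eval M e t) (eval M e u)
  | fBot => False
  | fImp A B => sat M e A -> sat M e B
  | fAnd A B => sat M e A /\ sat M e B
  | fOr A B => sat M e A \/ sat M e B
  | fAll A => forall d, sat M (env_cons d e) A
  | fEx A => exists d, sat M (env_cons d e) A
  end.

Definition models (M : structure) (A : form) : Prop := forall e, sat M e A.

Definition valid (A : form) : Prop := forall M : structure, models M A.

Definition Nstd : structure :=
  {| dom := nat; i_zero := 0; i_succ := S;
     i_add := Nat.add; i_mul := Nat.mul; i_le := le |}.

(** * The theory R_0 *)

Fixpoint num (n : nat) : term :=
  match n with 0 => tZero | S n => tSucc (num n) end.

Fixpoint eq_some_num_upto (t : term) (n : nat) : form :=
  match n with
  | 0 => fEq t (num 0)
  | S m => fOr (eq_some_num_upto t m) (fEq t (num n))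
  end.

Inductive R0 : theory :=
| R0_add m n : R0 (fEq (tAdd (num m) (num n)) (num (m + n)))
| R0_mul m n : R0 (fEq (tMul (num m) (num n)) (num (m * n)))
| R0_neq m n : m <> n -> R0 (fNeg (fEq (num m) (num n)))
| R0_bound n :
    R0 (fAll (fImp (fLe (tVar 0) (num n)) (eq_some_num_upto (tVar 0) n)))
| R0_le m n : m <= n -> R0 (fLe (num m) (num n)).

(** * Formula classes *)

(** Bounded quantification by [<] is admitted alongside [<=]; since [t < u]
    abbreviates [t <= u /\ t <> u], the two are not the same syntactic form. *)
Inductive Delta0 : form -> Prop :=
| Delta0_eq t u : Delta0 (fEq t u)
| Delta0_le t u : Delta0 (fLe t u)
| Delta0_bot : Delta0 fBot
| Delta0_imp A B : Delta0 A -> Delta0 B -> Delta0 (fImp A B)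
| Delta0_and A B : Delta0 A -> Delta0 B -> Delta0 (fAnd A B)
| Delta0_or A B : Delta0 A -> Delta0 B -> Delta0 (fOr A B)
| Delta0_allLe t A : Delta0 A -> Delta0 (allLe t A)
| Delta0_allLt t A : Delta0 A -> Delta0 (allLt t A)
| Delta0_exLe t A : Delta0 A -> Delta0 (exLe t A)
| Delta0_exLt t A : Delta0 A -> Delta0 (exLt t A).

Inductive Sigma1 : form -> Prop :=
| Sigma1_Delta0 A : Delta0 A -> Sigma1 A
| Sigma1_ex A : Sigma1 A -> Sigma1 (fEx A).

Definition Sigma1_sentence (A : form) : Prop := Sigma1 A /\ sentence A.

Definition one_Sigma1_sentence (A : form) : Prop :=
  (exists D, A = fEx D /\ Delta0 D) /\ sentence A.

Inductive pure_eq : term -> term -> Prop :=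
| pure_eq_var i j : pure_eq (tVar i) (tVar j)
| pure_eq_zero i : pure_eq tZero (tVar i)
| pure_eq_succ i j : pure_eq (tSucc (tVar i)) (tVar j)
| pure_eq_add i j k : pure_eq (tAdd (tVar i) (tVar j)) (tVar k)
| pure_eq_mul i j k : pure_eq (tMul (tVar i) (tVar j)) (tVar k).

Fixpoint pure_atoms (A : form) : Prop :=
  match A with
  | fEq t u => pure_eq t u
  | fLe t u => exists i j, t = tVar i /\ u = tVar j
  | fBot => True
  | fImp A B | fAnd A B | fOr A B => pure_atoms A /\ pure_atoms B
  | fAll A | fEx A => pure_atoms A
  end.

(** The atoms inside the quantifier bounds count, so bounds are variables. *)
Definition pure_Delta0 (A : form) : Prop := Delta0 A /\ pure_atoms A.

Definition pure_one_Sigma1_sentence (A : form) : Prop :=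
  (exists D, A = fEx D /\ pure_Delta0 D) /\ sentence A.

(** * Witness comparison *)

(** [A] and [B] are the matrices of the sentences [fEx A] and [fEx B], with
    free variable [tVar 0]; [up shift] makes room for the witness of [A]
    between the witness of [B] and the rest of the context. *)
Definition wit_le (A B : form) : form :=
  fEx (fAnd A (allLt (tVar 0) (fNeg (fsubst (up shift) B)))).
Definition wit_lt (A B : form) : form :=
  fEx (fAnd A (allLe (tVar 0) (fNeg (fsubst (up shift) B)))).

(** * Certified sentences *)

Definition wb : form :=
  fAnd (fLe tZero (tVar 0))
       (allLt (tVar 0) (fLe (tSucc (tVar 0)) (tVar 1))).

Fixpoint conj_list (l : list form) : form :=
  match l with
  | [] => fImp fBot fBot
  | [A] => A
  | A :: l => fAnd A (conj_list l)
  end.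

(** The free variable v is [tVar 0] outside all quantifiers. Quantified
    variables are introduced in the order x, y, z, w, so that e.g. under
    three quantifiers x, y, z, v are [tVar 2], [tVar 1], [tVar 0], [tVar 3]. *)
Definition cert : form :=
  conj_list
   [ fLe tZero (tVar 0);
     allLt (tVar 0) (fLe (tSucc (tVar 0)) (tVar 1));
     fAll (fIff (fLe (tVar 0) tZero) (fEq (tVar 0) tZero));
     allLt (tVar 0)
       (fAll (fIff (fLe (tVar 0) (tSucc (tVar 1)))
                   (fOr (fLe (tVar 0) (tVar 1))
                        (fEq (tVar 0) (tSucc (tVar 1))))));
     allLe (tVar 0) (allLe (tVar 1) (allLe (tVar 2)
       (fNeg (fEq (tSucc (tAdd (tMul (tVar 2) (tVar 1)) (tVar 0))) tZero))));
     allLe (tVar 0) (allLe (tVar 1) (allLe (tVar 2) (allLe (tVar 3)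
       (fImp (fEq (tSucc (tAdd (tMul (tVar 3) (tVar 2)) (tVar 1)))
                  (tSucc (tVar 0)))
             (fEq (tAdd (tMul (tVar 3) (tVar 2)) (tVar 1)) (tVar 0))))));
     allLe (tVar 0) (allLe (tVar 1)
       (fEq (tAdd (tMul (tVar 1) (tVar 0)) tZero)
            (tMul (tVar 1) (tVar 0))));
     allLe (tVar 0) (allLe (tVar 1) (allLe (tVar 2)
       (fEq (tAdd (tMul (tVar 2) (tVar 1)) (tSucc (tVar 0)))
            (tSucc (tAdd (tMul (tVar 2) (tVar 1)) (tVar 0))))));
     allLe (tVar 0) (fEq (tMul (tVar 0) tZero) tZero);
     allLe (tVar 0) (allLe (tVar 1)
       (fEq (tMul (tVar 1) (tSucc (tVar 0)))
            (tAdd (tMul (tVar 1) (tVar 0)) (tVar 1)))) ].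

(** [fEx rho0] is an admissible choice of the pure form of [rho]. *)
Definition pure_form_of (rho rho0 : form) : Prop :=
  pure_one_Sigma1_sentence (fEx rho0) /\
  models Nstd (fIff rho (fEx rho0)) /\
  valid (fImp (fEx rho0) rho).

(** The certified sentence, as a function of the pure matrix [rho0]. *)
Definition certified (rho0 : form) : form := fEx (fAnd cert rho0).

(* Main.v *)
(** A semantic argument, transferred to derivability by Henkin's theorem.
    Suppose a structure M satisfies [cert x] and [rho0 x].  If x is the value
    of a numeral k, taken least, the certificate makes M agree with the
    standard model on pure bounded formulas with parameters up to k, so rho is
    true in the standard model.  Otherwise the certificate makes all of R0
    true in M, and rho holds in M because [fEx rho0] implies it logically.
    Either way rho, and hence the comparison in favour of sigma', holds in some
    model of R0, with a witness y for sigma'.  Let n be the standard witness of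
    sigma that precedes all those of sigma'.  As y satisfies [wb], it is the
    value of a numeral smaller than n or lies above n.  In the first case
    sigma' has a standard witness below n, in the second n is a witness of
    sigma below y, both by absoluteness of bounded formulas in models of R0;
    either contradicts one of the two comparisons. *)

From Stdlib Require Import List Arith Lia Cantor.
From Stdlib Require Import Classical ClassicalEpsilon FunctionalExtensionality
  PropExtensionality ProofIrrelevance.
Require Import Defs.
Import ListNotations.

(** * Substitution *)

Lemma tsubst_comp r s t :
  tsubst r (tsubst s t) = tsubst (fun n => tsubst r (s n)) t.
Proof. induction t; simpl; congruence. Qed.

Lemma up_comp r s :
  (fun n => tsubst (up r) (up s n)) = up (fun n => tsubst r (s n)).
Proof.
  apply functional_extensionality; intros [|n]; [reflexivity|].
  unfold up at 2 3; simpl. rewrite !tsubst_comp. reflexivity.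
Qed.

Lemma fsubst_comp A : forall r s,
  fsubst r (fsubst s A) = fsubst (fun n => tsubst r (s n)) A.
Proof.
  induction A; intros r s; simpl; rewrite ?tsubst_comp, ?IHA1, ?IHA2;
    try reflexivity; rewrite IHA, up_comp; reflexivity.
Qed.

Lemma tsubst_var t : tsubst tVar t = t.
Proof. induction t; simpl; congruence. Qed.

Lemma up_var : up tVar = tVar.
Proof. apply functional_extensionality; intros [|n]; reflexivity. Qed.

Lemma fsubst_var A : fsubst tVar A = A.
Proof.
  induction A; simpl; rewrite ?tsubst_var, ?up_var; congruence.
Qed.

Lemma tinst_shift u t : tsubst (scons u tVar) (tsubst shift t) = t.
Proof. rewrite tsubst_comp. apply tsubst_var. Qed.

Lemma finst_up t s A : finst t (fsubst (up s) A) = fsubst (scons t s) A.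
Proof.
  unfold finst. rewrite fsubst_comp. f_equal.
  apply functional_extensionality; intros [|n]; [reflexivity|].
  unfold up; simpl. apply tinst_shift.
Qed.

Lemma fsubst_finst s t A :
  fsubst s (finst t A) = finst (tsubst s t) (fsubst (up s) A).
Proof.
  rewrite finst_up. unfold finst. rewrite fsubst_comp. f_equal.
  apply functional_extensionality; intros [|n]; reflexivity.
Qed.

Lemma fsubst_up_shift s A :
  fsubst (up s) (fsubst shift A) = fsubst shift (fsubst s A).
Proof. rewrite !fsubst_comp. reflexivity. Qed.

Lemma tsubst_agree k s r t :
  tvars_below k t -> (forall n, n < k -> s n = r n) -> tsubst s t = tsubst r t.
Proof.
  induction t; simpl; intros Ht Hk; auto; f_equal; firstorder.
Qed.

Lemma fsubst_agree A : forall k s r,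
  free_below k A -> (forall n, n < k -> s n = r n) -> fsubst s A = fsubst r A.
Proof.
  assert (Hup : forall k s r, (forall n, n < k -> s n = r n) ->
    forall n, n < S k -> up s n = up r n).
  { intros k s r H [|n] Hn; [reflexivity|]. unfold up; simpl.
    rewrite H by lia. reflexivity. }
  induction A; simpl; intros k s r HA Hk; auto; f_equal;
    try (eapply tsubst_agree; [apply HA|assumption]);
    try (eapply IHA1; [apply HA|assumption]);
    try (eapply IHA2; [apply HA|assumption]);
    eapply IHA; eauto.
Qed.

Lemma tvars_below_le k k' t : k <= k' -> tvars_below k t -> tvars_below k' t.
Proof. induction t; simpl; intuition lia. Qed.

Lemma free_below_le A : forall k k', k <= k' -> free_below k A -> free_below k' A.
Proof.
  induction A; simpl; intros k k' Hk HA;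
    try (destruct HA; split; eauto using tvars_below_le); auto;
    (eapply IHA; [|exact HA]; lia).
Qed.

Lemma tvars_below_exists t : exists k, tvars_below k t.
Proof.
  induction t as [n| |t IH|t [k Hk] u [l Hl]|t [k Hk] u [l Hl]]; simpl.
  - exists (S n). lia.
  - exists 0. exact I.
  - exact IH.
  - exists (max k l). split; (eapply tvars_below_le; [|eassumption]); lia.
  - exists (max k l). split; (eapply tvars_below_le; [|eassumption]); lia.
Qed.

Lemma free_below_exists A : exists k, free_below k A.
Proof.
  induction A as [t u|t u| |A [k Hk] B [l Hl]|A [k Hk] B [l Hl]
    |A [k Hk] B [l Hl]|A [k Hk]|A [k Hk]]; simpl.
  1,2: destruct (tvars_below_exists t) as [k Hk], (tvars_below_exists u) as [l Hl];
    exists (max k l); split; (eapply tvars_below_le; [|eassumption]); lia.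
  1: exists 0; exact I.
  1,2,3: exists (max k l); split; (eapply free_below_le; [|eassumption]); lia.
  1,2: exists k; eapply free_below_le; [|eassumption]; lia.
Qed.

Lemma free_below_exists_list L : exists k, Forall (free_below k) L.
Proof.
  induction L as [|A L [k Hk]].
  - exists 0. constructor.
  - destruct (free_below_exists A) as [l Hl]. exists (max k l). constructor.
    + eapply free_below_le; [|exact Hl]; lia.
    + eapply Forall_impl; [|exact Hk]. intros B. apply free_below_le. lia.
Qed.

(** * Derivations *)

Lemma Prf_weaken G A : Prf G A -> forall G', incl G G' -> Prf G' A.
Proof.
  assert (Hc : forall (B : form) G G', incl G G' -> incl (B :: G) (B :: G')).
  { intros B L L' H C [->|HC]; [left; reflexivity|right; auto]. }
  induction 1; intros G' HG.
  - apply Prf_ax; auto.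
  - apply Prf_raa; auto.
  - apply Prf_impI; auto.
  - eapply Prf_impE; eauto.
  - apply Prf_andI; auto.
  - eapply Prf_andE1; eauto.
  - eapply Prf_andE2; eauto.
  - apply Prf_orI1; auto.
  - apply Prf_orI2; auto.
  - eapply Prf_orE; eauto.
  - apply Prf_allI, IHPrf, incl_map, HG.
  - apply Prf_allE; auto.
  - eapply Prf_exI; eauto.
  - eapply Prf_exE; eauto using incl_map.
  - apply Prf_eqI.
  - eapply Prf_eqE; eauto.
Qed.

Lemma Prf_subst G A : Prf G A -> forall s, Prf (map (fsubst s) G) (fsubst s A).
Proof.
  assert (Hmap : forall s G, map (fsubst (up s)) (map (fsubst shift) G)
    = map (fsubst shift) (map (fsubst s) G)).
  { intros s L. rewrite !map_map. apply map_ext. intros B. apply fsubst_up_shift. }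
  induction 1; intros s; simpl in *.
  - apply Prf_ax, in_map; auto.
  - apply Prf_raa, IHPrf.
  - apply Prf_impI; auto.
  - eapply Prf_impE; [apply IHPrf1|apply IHPrf2].
  - apply Prf_andI; auto.
  - eapply Prf_andE1; apply IHPrf.
  - eapply Prf_andE2; apply IHPrf.
  - apply Prf_orI1; auto.
  - apply Prf_orI2; auto.
  - eapply Prf_orE; [apply IHPrf1|apply IHPrf2|apply IHPrf3].
  - apply Prf_allI. rewrite <- Hmap. apply IHPrf.
  - rewrite fsubst_finst. apply Prf_allE, IHPrf.
  - eapply Prf_exI. rewrite <- fsubst_finst. apply IHPrf.
  - eapply Prf_exE; [apply IHPrf1|].
    rewrite <- Hmap, <- fsubst_up_shift. apply IHPrf2.
  - apply Prf_eqI.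
  - rewrite fsubst_finst. eapply Prf_eqE; [apply IHPrf1|].
    rewrite <- fsubst_finst. apply IHPrf2.
Qed.

Lemma Prf_cut G A B : Prf G A -> Prf (A :: G) B -> Prf G B.
Proof. intros HA HB. eapply Prf_impE; [apply Prf_impI, HB|exact HA]. Qed.

(** The renaming [s] sends the variable [k] to 0 and shifts all others. On formulas with free
    variables below [k] it acts as [shift], and it turns the instance of [A] at [k] back into [A],
    so the given derivation becomes the premise of [Prf_exE]. *)
Lemma Prf_fresh_witness k G A :
  free_below k (fEx A) -> Forall (free_below k) G ->
  Prf (finst (tVar k) A :: fEx A :: G) fBot -> Prf (fEx A :: G) fBot.
Proof.
  intros HA HG H.
  set (s := fun n => if n =? k then tVar 0 else tVar (S n)).
  assert (Hs : forall n, n < k -> s n = shift n).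
  { intros n Hn. unfold s. destruct (Nat.eqb_spec n k); [lia|reflexivity]. }
  apply Prf_exE with (A := A); [apply Prf_ax; left; reflexivity|].
  apply Prf_subst with (s := s) in H. simpl in H.
  replace (map (fsubst s) G) with (map (fsubst shift) G) in H.
  2: { apply map_ext_in. intros B HB. symmetry. eapply fsubst_agree; [|exact Hs].
       revert B HB. apply Forall_forall, HG. }
  replace (fsubst s (finst (tVar k) A)) with A in H.
  2: { rewrite <- (fsubst_var A) at 1. unfold finst. rewrite fsubst_comp.
       apply fsubst_agree with (k := S k); [exact HA|].
       intros [|n] Hn; simpl.
       - unfold s. rewrite Nat.eqb_refl. reflexivity.
       - symmetry. apply Hs. lia. }
  change (fEx (fsubst (up s) A)) with (fsubst s (fEx A)) in H.
  rewrite (fsubst_agree _ _ _ _ HA Hs) in H. exact H.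
Qed.

(** * Soundness *)

Lemma eval_subst M e s t :
  eval M e (tsubst s t) = eval M (fun n => eval M e (s n)) t.
Proof. induction t; simpl; congruence. Qed.

Lemma sat_subst M A : forall e s,
  sat M e (fsubst s A) <-> sat M (fun n => eval M e (s n)) A.
Proof.
  assert (Hup : forall e s d, (fun n => eval M (env_cons d e) (up s n))
    = env_cons d (fun n => eval M e (s n))).
  { intros e s d. apply functional_extensionality; intros [|n]; [reflexivity|].
    unfold up; simpl. rewrite eval_subst. reflexivity. }
  induction A; intros e s; simpl; rewrite ?eval_subst; try reflexivity;
    try (rewrite IHA1, IHA2; reflexivity).
  - split; intros H d; specialize (H d); rewrite IHA, Hup in *; exact H.
  - split; intros [d H]; exists d; rewrite IHA, Hup in *; exact H.
Qed.

Lemma sat_shift M e d A : sat M (env_cons d e) (fsubst shift A) <-> sat M e A.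
Proof. rewrite sat_subst. reflexivity. Qed.

Lemma sat_finst M e t A : sat M e (finst t A) <-> sat M (env_cons (eval M e t) e) A.
Proof.
  unfold finst. rewrite sat_subst.
  replace (fun n => eval M e (scons t tVar n)) with (env_cons (eval M e t) e).
  - reflexivity.
  - apply functional_extensionality; intros [|n]; reflexivity.
Qed.

Lemma soundness M G A : Prf G A -> forall e, Forall (sat M e) G -> sat M e A.
Proof.
  assert (Hsh : forall G e d, Forall (sat M e) G ->
    Forall (sat M (env_cons d e)) (map (fsubst shift) G)).
  { intros L e d H. apply Forall_map. eapply Forall_impl; [|exact H].
    intros B. apply sat_shift. }
  induction 1; intros e HG; simpl in *.
  - revert A H. apply Forall_forall, HG.
  - apply NNPP. intros HA. apply (IHPrf e). constructor; [exact HA|exact HG].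
  - intros HA. apply IHPrf. constructor; assumption.
  - apply (IHPrf1 e HG). auto.
  - auto.
  - apply (IHPrf e HG).
  - apply (IHPrf e HG).
  - auto.
  - auto.
  - destruct (IHPrf1 e HG); [apply IHPrf2|apply IHPrf3]; constructor; assumption.
  - intros d. apply IHPrf, Hsh, HG.
  - apply sat_finst, (IHPrf e HG).
  - exists (eval M e t). apply sat_finst; auto.
  - destruct (IHPrf1 e HG) as [d Hd]. apply (sat_shift M e d).
    apply IHPrf2. constructor; [exact Hd|apply Hsh, HG].
  - reflexivity.
  - specialize (IHPrf2 e HG). rewrite sat_finst in *.
    rewrite <- (IHPrf1 e HG). exact IHPrf2.
Qed.

Lemma eval_agree M k e e' t :
  tvars_below k t -> (forall n, n < k -> e n = e' n) -> eval M e t = eval M e' t.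
Proof. induction t; simpl; intros Ht Hk; auto; f_equal; firstorder. Qed.

Lemma sat_agree M A : forall k e e',
  free_below k A -> (forall n, n < k -> e n = e' n) -> (sat M e A <-> sat M e' A).
Proof.
  assert (Hc : forall d k e e', (forall n, n < k -> e n = e' n) ->
    forall n, n < S k -> @env_cons (dom M) d e n = env_cons d e' n).
  { intros d k e e' H [|n] Hn; [reflexivity|]. apply H. lia. }
  induction A; intros k e e' HA Hk; simpl in *.
  1,2: rewrite (eval_agree M k e e' t), (eval_agree M k e e' u) by tauto; reflexivity.
  1: reflexivity.
  1,2,3: rewrite (IHA1 k e e'), (IHA2 k e e') by tauto; reflexivity.
  - split; intros H d; specialize (H d);
      apply (IHA _ (env_cons d e) (env_cons d e') HA (Hc d k e e' Hk)), H.
  - split; intros [d H]; exists d;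
      apply (IHA _ (env_cons d e) (env_cons d e') HA (Hc d k e e' Hk)), H.
Qed.

(** * Henkin's model existence theorem *)

Fixpoint tcode (t : term) : nat :=
  match t with
  | tVar n => to_nat (0, n)
  | tZero => to_nat (1, 0)
  | tSucc t => to_nat (2, tcode t)
  | tAdd t u => to_nat (3, to_nat (tcode t, tcode u))
  | tMul t u => to_nat (4, to_nat (tcode t, tcode u))
  end.

Fixpoint fcode (A : form) : nat :=
  match A with
  | fEq t u => to_nat (0, to_nat (tcode t, tcode u))
  | fLe t u => to_nat (1, to_nat (tcode t, tcode u))
  | fBot => to_nat (2, 0)
  | fImp A B => to_nat (3, to_nat (fcode A, fcode B))
  | fAnd A B => to_nat (4, to_nat (fcode A, fcode B))
  | fOr A B => to_nat (5, to_nat (fcode A, fcode B))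
  | fAll A => to_nat (6, fcode A)
  | fEx A => to_nat (7, fcode A)
  end.

Lemma pair_code_inj a b c d : to_nat (a, b) = to_nat (c, d) -> a = c /\ b = d.
Proof. intros H. apply to_nat_inj in H. injection H. auto. Qed.

Ltac split_codes :=
  repeat match goal with
  | H : to_nat _ = to_nat _ |- _ => apply pair_code_inj in H as [? ?]
  end.

Lemma tcode_inj t : forall u, tcode t = tcode u -> t = u.
Proof.
  induction t; intros [] H; cbn [tcode] in H; split_codes;
    try discriminate; f_equal; auto.
Qed.

Lemma fcode_inj A : forall B, fcode A = fcode B -> A = B.
Proof.
  induction A; intros [] H; cbn [fcode] in H; split_codes;
    try discriminate; f_equal; auto using tcode_inj.
Qed.

(** Enumerates all formulas, [A] occurring at index [fcode A]. A number that codes nothing yields an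
    arbitrary formula, which the construction treats like any other. *)
Definition form_of (n : nat) : form :=
  epsilon (inhabits fBot) (fun A => fcode A = n).

Lemma form_of_fcode A : form_of (fcode A) = A.
Proof.
  apply fcode_inj. unfold form_of.
  apply (epsilon_spec (inhabits fBot) (fun B => fcode B = fcode A)).
  exists A. reflexivity.
Qed.

Definition fresh (L : list form) : nat :=
  epsilon (inhabits 0) (fun k => Forall (free_below k) L).

Lemma fresh_spec L : Forall (free_below (fresh L)) L.
Proof.
  apply (epsilon_spec (inhabits 0) (fun k => Forall (free_below k) L)).
  apply free_below_exists_list.
Qed.

(** Variables play the part of Henkin constants: each stage is a finite list, so some variable lies
    above all those free in it. *)
Definition add_witness (A : form) (L : list form) : list form :=
  match A with
  | fEx B => finst (tVar (fresh (A :: L))) B :: A :: L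
  | _ => A :: L
  end.

Fixpoint henkin (G : list form) (n : nat) : list form :=
  match n with
  | 0 => G
  | S n =>
      let L := henkin G n in
      if excluded_middle_informative (Prf (form_of n :: L) fBot) then L
      else add_witness (form_of n) L
  end.

Lemma add_witness_incl A L : incl (A :: L) (add_witness A L).
Proof.
  destruct A; simpl; try apply incl_refl. apply incl_tl, incl_refl.
Qed.

Lemma add_witness_consistent A L :
  ~ Prf (A :: L) fBot -> ~ Prf (add_witness A L) fBot.
Proof.
  intros HA. destruct A; simpl; auto.
  intros H. apply HA. pose proof (fresh_spec (fEx A :: L)) as Hk.
  inversion Hk; subst.
  eapply Prf_fresh_witness; [| |exact H]; assumption.
Qed.

Section Henkin.

Variable G : list form.
Hypothesis G_consistent : ~ Prf G fBot.

Definition Thy (A : form) : Prop := exists n, In A (henkin G n).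

Lemma henkin_consistent n : ~ Prf (henkin G n) fBot.
Proof.
  induction n; simpl; auto.
  destruct (excluded_middle_informative _); auto using add_witness_consistent.
Qed.

Lemma henkin_mono m n : m <= n -> incl (henkin G m) (henkin G n).
Proof.
  induction 1; [apply incl_refl|]. eapply incl_tran; [exact IHle|]. simpl.
  destruct (excluded_middle_informative _); [apply incl_refl|].
  eapply incl_tran; [|apply add_witness_incl]. apply incl_tl, incl_refl.
Qed.

Lemma henkin_decide A :
  incl (add_witness A (henkin G (fcode A))) (henkin G (S (fcode A)))
  \/ Prf (A :: henkin G (fcode A)) fBot.
Proof.
  simpl. rewrite form_of_fcode.
  destruct (excluded_middle_informative _); [right|left]; auto using incl_refl.
Qed.

Lemma T_list L : Forall Thy L -> exists n, incl L (henkin G n).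
Proof.
  induction 1 as [|A L [n Hn] _ [m Hm]].
  - exists 0. apply incl_nil_l.
  - exists (max n m). apply incl_cons.
    + apply (henkin_mono n); [lia|exact Hn].
    + eapply incl_tran; [exact Hm|]. apply henkin_mono; lia.
Qed.

Lemma T_consistent L : Forall Thy L -> ~ Prf L fBot.
Proof.
  intros HL H. apply T_list in HL as [n Hn].
  apply (henkin_consistent n). eapply Prf_weaken; eauto.
Qed.

(** Stages increase, so a single stage contains both [L] and [henkin G n]; a cut on [A] would make
    it inconsistent. *)
Lemma T_not_refuted L A n : Forall Thy L -> Prf L A -> ~ Prf (A :: henkin G n) fBot.
Proof.
  intros HL HA H. apply T_list in HL as [m Hm].
  apply (henkin_consistent (max m n)). apply Prf_cut with A.
  - eapply Prf_weaken; [exact HA|]. eapply incl_tran; [exact Hm|].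
    apply henkin_mono; lia.
  - eapply Prf_weaken; [exact H|]. apply incl_cons; [left; reflexivity|].
    apply incl_tl, henkin_mono; lia.
Qed.

Lemma T_closed L A : Forall Thy L -> Prf L A -> Thy A.
Proof.
  intros HL HA. destruct (henkin_decide A) as [H|H].
  - exists (S (fcode A)). apply H, add_witness_incl. left; reflexivity.
  - destruct (T_not_refuted L A _ HL HA H).
Qed.

Lemma T_complete A : Thy A \/ Thy (fNeg A).
Proof.
  destruct (henkin_decide A) as [H|H].
  - left. exists (S (fcode A)). apply H, add_witness_incl. left; reflexivity.
  - right. apply T_closed with (henkin G (fcode A)); [|apply Prf_impI, H].
    apply Forall_forall. intros B HB. exists (fcode A). exact HB.
Qed.

Lemma T_closed1 A B : Thy A -> Prf [A] B -> Thy B.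
Proof. intros HA. apply T_closed. auto. Qed.

Lemma T_closed2 A B C : Thy A -> Thy B -> Prf [A; B] C -> Thy C.
Proof. intros HA HB. apply T_closed. auto. Qed.

Lemma T_bot : ~ Thy fBot.
Proof.
  intros H. apply (T_consistent [fBot]); auto. apply Prf_ax; left; reflexivity.
Qed.

Lemma T_imp A B : Thy (fImp A B) <-> (Thy A -> Thy B).
Proof.
  split.
  - intros HI HA. apply (T_closed2 _ _ _ HI HA).
    apply Prf_impE with A; apply Prf_ax; simpl; auto.
  - intros H. destruct (T_complete A) as [HA|HA].
    + apply (T_closed1 B); auto. apply Prf_impI, Prf_ax; simpl; auto.
    + apply (T_closed1 _ _ HA). apply Prf_impI, Prf_raa.
      apply Prf_impE with A; apply Prf_ax; simpl; auto.
Qed.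

Lemma T_and A B : Thy (fAnd A B) <-> Thy A /\ Thy B.
Proof.
  split.
  - intros H. split; apply (T_closed1 _ _ H);
      [eapply Prf_andE1|eapply Prf_andE2]; apply Prf_ax; left; reflexivity.
  - intros [HA HB]. apply (T_closed2 _ _ _ HA HB).
    apply Prf_andI; apply Prf_ax; simpl; auto.
Qed.

Lemma T_or A B : Thy (fOr A B) <-> Thy A \/ Thy B.
Proof.
  split.
  - intros H. destruct (T_complete A) as [HA|HA]; [auto|right].
    apply (T_closed2 _ _ _ H HA).
    apply Prf_orE with A B; [apply Prf_ax; simpl; auto| |apply Prf_ax; simpl; auto].
    apply Prf_raa. apply Prf_impE with A; apply Prf_ax; simpl; auto.
  - intros [H|H]; apply (T_closed1 _ _ H);
      [apply Prf_orI1|apply Prf_orI2]; apply Prf_ax; left; reflexivity.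
Qed.

Lemma T_ex A : Thy (fEx A) <-> exists t, Thy (finst t A).
Proof.
  split.
  - intros H. destruct (henkin_decide (fEx A)) as [Hi|Hb].
    (* The witness is the fresh variable added together with [fEx A]. *)
    + eexists. exists (S (fcode (fEx A))). apply Hi. left; reflexivity.
    + exfalso. apply (T_not_refuted [fEx A] (fEx A) (fcode (fEx A))); auto.
      apply Prf_ax; left; reflexivity.
  - intros [t H]. apply (T_closed1 _ _ H). eapply Prf_exI, Prf_ax; left; reflexivity.
Qed.

(** From right to left, completeness is applied to [fEx (fNeg A)]: if it belongs to the theory, its
    witness contradicts an instance of [A]; if its negation does, [A] follows for a generic
    variable. *)
Lemma T_all A : Thy (fAll A) <-> forall t, Thy (finst t A).
Proof.
  split.
  - intros H t. apply (T_closed1 _ _ H), Prf_allE, Prf_ax; left; reflexivity.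
  - intros H. destruct (T_complete (fEx (fNeg A))) as [HE|HE].
    + apply T_ex in HE as [t Ht]. destruct T_bot.
      apply (proj1 (T_imp _ _) Ht (H t)).
    + apply (T_closed1 _ _ HE), Prf_allI, Prf_raa. simpl.
      apply Prf_impE with (fsubst shift (fEx (fNeg A)));
        [apply Prf_ax; simpl; auto|].
      (* The eigenvariable of [Prf_allI] is [tVar 0]; taken as the witness, it turns the shifted
         matrix back into [fNeg A]. *)
      apply Prf_exI with (tVar 0). fold (fsubst (up shift) (fNeg A)).
      rewrite finst_up. replace (scons (tVar 0) shift) with tVar.
      * rewrite fsubst_var. apply Prf_ax; left; reflexivity.
      * apply functional_extensionality; intros [|n]; reflexivity.
Qed.

Lemma T_eq_refl t : Thy (fEq t t).
Proof. apply (T_closed []); [constructor|apply Prf_eqI]. Qed.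

Lemma T_eq_subst A t u : Thy (fEq t u) -> Thy (finst t A) -> Thy (finst u A).
Proof.
  intros He Ht. apply (T_closed2 _ _ _ He Ht).
  apply Prf_eqE with t; apply Prf_ax; simpl; auto.
Qed.

Lemma T_eq_sym t u : Thy (fEq t u) -> Thy (fEq u t).
Proof.
  intros H. pose proof (T_eq_subst (fEq (tVar 0) (tsubst shift t)) t u H) as K.
  unfold finst in K; simpl in K. rewrite !tinst_shift in K.
  apply K, T_eq_refl.
Qed.

Lemma T_eq_trans t u v : Thy (fEq t u) -> Thy (fEq u v) -> Thy (fEq t v).
Proof.
  intros Ht Hv. pose proof (T_eq_subst (fEq (tsubst shift t) (tVar 0)) u v Hv) as K.
  unfold finst in K; simpl in K. rewrite !tinst_shift in K.
  apply K, Ht.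
Qed.

(** Leibniz's rule is applied to an equation whose left side is [c] with [t] already inserted and
    whose right side is [c] with its variable 0 open; at [t] this is reflexivity. *)
Lemma T_eq_congr c t u :
  Thy (fEq t u) -> Thy (fEq (tsubst (scons t tVar) c) (tsubst (scons u tVar) c)).
Proof.
  intros H.
  pose proof (T_eq_subst
    (fEq (tsubst shift (tsubst (scons t tVar) c)) c) t u H) as K.
  unfold finst in K; simpl in K. rewrite !tinst_shift in K.
  apply K, T_eq_refl.
Qed.

(** The arguments are exchanged one after the other, each time by the unary case for a template in
    which the other argument is fixed. *)
Lemma T_eq_congr2 c t t' u u' :
  Thy (fEq t t') -> Thy (fEq u u') ->
  Thy (fEq (tsubst (scons t (scons u tVar)) c) (tsubst (scons t' (scons u' tVar)) c)).
Proof.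
  intros Ht Hu.
  apply T_eq_trans with (tsubst (scons t' (scons u tVar)) c).
  - pose proof (T_eq_congr (tsubst (up (scons u tVar)) c) _ _ Ht) as K.
    rewrite !tsubst_comp in K. revert K.
    match goal with |- Thy (fEq (tsubst ?r _) (tsubst ?s _)) -> _ =>
      replace r with (scons t (scons u tVar));
      [replace s with (scons t' (scons u tVar)); [auto|]|] end;
    apply functional_extensionality; intros [|[|n]]; try reflexivity;
      cbn -[tsubst]; rewrite ?tinst_shift; reflexivity.
  - pose proof (T_eq_congr
      (tsubst (scons (tsubst shift t') (scons (tVar 0) shift)) c) _ _ Hu) as K.
    rewrite !tsubst_comp in K. revert K.
    match goal with |- Thy (fEq (tsubst ?r _) (tsubst ?s _)) -> _ =>
      replace r with (scons t' (scons u tVar));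
      [replace s with (scons t' (scons u' tVar)); [auto|]|] end;
    apply functional_extensionality; intros [|[|n]]; try reflexivity;
      cbn -[tsubst]; rewrite ?tinst_shift; reflexivity.
Qed.

Lemma T_le_congr t t' u u' :
  Thy (fEq t t') -> Thy (fEq u u') -> Thy (fLe t u) -> Thy (fLe t' u').
Proof.
  intros Ht Hu H.
  pose proof (T_eq_subst (fLe (tVar 0) (tsubst shift u)) t t' Ht) as K1.
  pose proof (T_eq_subst (fLe (tsubst shift t') (tVar 0)) u u' Hu) as K2.
  unfold finst in K1, K2; simpl in K1, K2.
  rewrite !tinst_shift in K1, K2. auto.
Qed.

(* The structures of the semantics interpret equality as identity, so the
   domain consists of one chosen term from each class of provably equal ones. *)
Definition rep (t : term) : term :=
  epsilon (inhabits tZero) (fun u => Thy (fEq t u)).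

Lemma rep_eq t : Thy (fEq t (rep t)).
Proof.
  apply (epsilon_spec (inhabits tZero) (fun u => Thy (fEq t u))).
  exists t. apply T_eq_refl.
Qed.

Lemma rep_iff t u : rep t = rep u <-> Thy (fEq t u).
Proof.
  split.
  - intros H. apply T_eq_trans with (rep t); [apply rep_eq|].
    rewrite H. apply T_eq_sym, rep_eq.
  - intros H. unfold rep. f_equal. apply functional_extensionality; intros v.
    apply propositional_extensionality.
    split; intros K; eapply T_eq_trans; eauto using T_eq_sym.
Qed.

Definition class : Type := {t : term | rep t = t}.

Definition cls (t : term) : class :=
  exist _ (rep t) (proj2 (rep_iff (rep t) t) (T_eq_sym _ _ (rep_eq t))).

Lemma cls_iff t u : cls t = cls u <-> Thy (fEq t u).
Proof.
  rewrite <- rep_iff. split.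
  - intros H. exact (f_equal (@proj1_sig _ _) H).
  - intros H. apply subset_eq_compat, H.
Qed.

Lemma cls_surj (d : class) : exists t, d = cls t.
Proof.
  exists (proj1_sig d). destruct d as [t Ht]. simpl.
  apply subset_eq_compat. symmetry; exact Ht.
Qed.

Definition term_model : structure :=
  {| dom := class;
     i_zero := cls tZero;
     i_succ d := cls (tSucc (proj1_sig d));
     i_add d d' := cls (tAdd (proj1_sig d) (proj1_sig d'));
     i_mul d d' := cls (tMul (proj1_sig d) (proj1_sig d'));
     i_le d d' := Thy (fLe (proj1_sig d) (proj1_sig d')) |}.

Lemma eval_term_model s t :
  eval term_model (fun n => cls (s n)) t = cls (tsubst s t).
Proof.
  induction t; simpl; rewrite ?IHt, ?IHt1, ?IHt2; simpl; try reflexivity;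
    apply cls_iff.
  - apply (T_eq_congr (tSucc (tVar 0))), T_eq_sym, rep_eq.
  - apply (T_eq_congr2 (tAdd (tVar 0) (tVar 1))); apply T_eq_sym, rep_eq.
  - apply (T_eq_congr2 (tMul (tVar 0) (tVar 1))); apply T_eq_sym, rep_eq.
Qed.

(** The truth lemma. Every element of the model is the class of a term, so quantification over the
    domain is quantification over terms, which [T_all] and [T_ex] describe. *)
Lemma sat_term_model A : forall s,
  sat term_model (fun n => cls (s n)) A <-> Thy (fsubst s A).
Proof.
  assert (Hc : forall t s,
    env_cons (cls t) (fun n => cls (s n)) = fun n => cls (scons t s n)).
  { intros t s. apply functional_extensionality; intros [|n]; reflexivity. }
  induction A; intros s; cbn [sat fsubst].
  - rewrite !eval_term_model. apply cls_iff.
  - rewrite !eval_term_model. simpl. split; apply T_le_congr;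
      auto using T_eq_sym, rep_eq.
  - split; [tauto|apply T_bot].
  - rewrite IHA1, IHA2, T_imp. reflexivity.
  - rewrite IHA1, IHA2, T_and. reflexivity.
  - rewrite IHA1, IHA2, T_or. reflexivity.
  - rewrite T_all. split.
    + intros H t. rewrite finst_up, <- IHA, <- Hc. apply H.
    + intros H d. destruct (cls_surj d) as [t ->].
      rewrite Hc, IHA, <- finst_up. apply H.
  - rewrite T_ex. split.
    + intros [d H]. destruct (cls_surj d) as [t ->]. exists t.
      rewrite finst_up, <- IHA, <- Hc. exact H.
    + intros [t H]. exists (cls t). rewrite Hc, IHA, <- finst_up. exact H.
Qed.

End Henkin.

Theorem model_existence G :
  ~ Prf G fBot -> exists M e, Forall (sat M e) G.
Proof.
  (* Each variable denotes its own class, so the truth lemma applies with the identity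
     substitution. *)
  intros HG. exists (term_model G HG), (fun n => cls G HG (tVar n)).
  apply Forall_forall. intros A HA. apply sat_term_model.
  rewrite fsubst_var. exists 0. exact HA.
Qed.

(** * Numerals *)

Definition nval (M : structure) (n : nat) : dom M :=
  Nat.iter n (i_succ M) (i_zero M).

Lemma nval_S M n : nval M (S n) = i_succ M (nval M n).
Proof. reflexivity. Qed.

Lemma eval_num M e n : eval M e (num n) = nval M n.
Proof. induction n; simpl; congruence. Qed.

Lemma nval_Nstd n : nval Nstd n = n.
Proof. induction n; simpl in *; congruence. Qed.

Lemma sat_eq_some_num_upto M e t n :
  sat M e (eq_some_num_upto t n) <-> exists i, i <= n /\ eval M e t = nval M i.
Proof.
  induction n as [|n IH]; cbn [eq_some_num_upto sat]; rewrite ?IH, eval_num.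
  - split; [intros H; exists 0; auto|].
    intros (i & Hi & H). replace 0 with i by lia. exact H.
  - split.
    + intros [(i & Hi & H)|H]; [exists i|exists (S n)]; auto.
    + intros (i & Hi & H). destruct (Nat.eq_dec i (S n)) as [->|]; [right; exact H|].
      left. exists i. split; [lia|exact H].
Qed.

(** The semantic content of [wb], and of the first two conjuncts of [cert]. *)
Definition below_closed (M : structure) (x : dom M) : Prop :=
  i_le M (i_zero M) x /\
  forall y, i_le M y x /\ y <> x -> i_le M (i_succ M y) x.

(* A well-behaved element is a numeral or lies above all numerals: only the
   numerals strictly below [n] need to be excluded to climb up to [n]. *)
Lemma below_closed_le M x n :
  below_closed M x -> (forall i, i < n -> nval M i <> x) -> i_le M (nval M n) x.
Proof.
  intros [H0 HS]. induction n as [|n IH]; intros H; [exact H0|].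
  apply HS. split; [apply IH|]; auto.
Qed.

(** * Absoluteness of bounded formulas in models of R0 *)

Section R0_models.

Variable M : structure.
Hypothesis M_R0 : forall A, R0 A -> models M A.

Let e0 : nat -> dom M := fun _ => i_zero M.

Lemma R0_eval_nval (e : nat -> nat) t :
  eval M (fun n => nval M (e n)) t = nval M (eval Nstd e t).
Proof.
  induction t; simpl in *; rewrite ?IHt, ?IHt1, ?IHt2; try reflexivity.
  - pose proof (M_R0 _ (R0_add (eval Nstd e t1) (eval Nstd e t2)) e0) as H.
    simpl in H. rewrite !eval_num in H. exact H.
  - pose proof (M_R0 _ (R0_mul (eval Nstd e t1) (eval Nstd e t2)) e0) as H.
    simpl in H. rewrite !eval_num in H. exact H.
Qed.

Lemma R0_nval_eq m n : nval M m = nval M n <-> m = n.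
Proof.
  split; [|congruence]. intros H. apply NNPP. intros Hn.
  apply (M_R0 _ (R0_neq m n Hn) e0). simpl. rewrite !eval_num. exact H.
Qed.

Lemma R0_le_nval d n : i_le M d (nval M n) <-> exists i, i <= n /\ d = nval M i.
Proof.
  split.
  - intros H. pose proof (M_R0 _ (R0_bound n) e0 d) as K. cbn [sat eval] in K.
    rewrite eval_num, sat_eq_some_num_upto in K. apply K, H.
  - intros (i & Hi & ->). pose proof (M_R0 _ (R0_le i n Hi) e0) as K.
    simpl in K. rewrite !eval_num in K. exact K.
Qed.

Lemma R0_nval_le m n : i_le M (nval M m) (nval M n) <-> m <= n.
Proof.
  rewrite R0_le_nval. split.
  - intros (i & Hi & H). apply R0_nval_eq in H. lia.
  - intros H. exists m. auto.
Qed.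

End R0_models.

Lemma env_cons_nval M i (e : nat -> nat) :
  env_cons (nval M i) (fun n => nval M (e n)) = fun n => nval M (env_cons i e n).
Proof. apply functional_extensionality; intros [|n]; reflexivity. Qed.

(* [P] and [Q] are the matrix of a bounded quantifier, read in M and in the
   standard model. *)
Lemma bounded_quantifiers_absolute M b (P : dom M -> Prop) (Q : nat -> Prop)
  (Hle : forall d, i_le M d (nval M b) <-> exists i, i <= b /\ d = nval M i)
  (Heq : forall i, i <= b -> (nval M i = nval M b <-> i = b))
  (HPQ : forall i, i <= b -> (P (nval M i) <-> Q i)) :
  ((forall d, i_le M d (nval M b) -> P d) <-> (forall i, i <= b -> Q i)) /\
  ((forall d, i_le M d (nval M b) /\ (d = nval M b -> False) -> P d)
     <-> (forall i, i <= b /\ (i = b -> False) -> Q i)) /\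
  ((exists d, i_le M d (nval M b) /\ P d) <-> (exists i, i <= b /\ Q i)) /\
  ((exists d, (i_le M d (nval M b) /\ (d = nval M b -> False)) /\ P d)
     <-> (exists i, (i <= b /\ (i = b -> False)) /\ Q i)).
Proof.
  assert (Hd : forall i, i <= b -> i_le M (nval M i) (nval M b)).
  { intros i Hi. apply Hle. exists i. auto. }
  repeat split.
  - intros H i Hi. apply HPQ; auto.
  - intros H d Hdb. apply Hle in Hdb as (i & Hi & ->). apply HPQ; auto.
  - intros H i [Hi Hn]. apply HPQ; auto. apply H. rewrite Heq; auto.
  - intros H d [Hdb Hn]. apply Hle in Hdb as (i & Hi & ->).
    rewrite Heq in Hn by assumption. apply HPQ; auto.
  - intros (d & Hdb & H). apply Hle in Hdb as (i & Hi & ->).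
    exists i. rewrite <- HPQ; auto.
  - intros (i & Hi & H). exists (nval M i). rewrite HPQ; auto.
  - intros (d & [Hdb Hn] & H). apply Hle in Hdb as (i & Hi & ->).
    rewrite Heq in Hn by assumption. exists i. rewrite <- HPQ; auto.
  - intros (i & [Hi Hn] & H). exists (nval M i).
    rewrite HPQ, Heq by assumption. auto.
Qed.

Lemma eval_shift M e d t : eval M (env_cons d e) (tsubst shift t) = eval M e t.
Proof. rewrite eval_subst. reflexivity. Qed.

Ltac unfold_bounded :=
  unfold allLe, allLt, exLe, exLt, fLt, fNeg; cbn [sat eval env_cons];
  repeat setoid_rewrite eval_shift.

(** At numeral parameters every bound evaluates to a numeral, and by [R0_le_nval] only numerals lie
    below it; a bounded quantifier thus ranges over the same elements in both structures. *)
Lemma Delta0_absolute M (M_R0 : forall A, R0 A -> models M A) A :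
  Delta0 A -> forall e : nat -> nat,
  sat M (fun n => nval M (e n)) A <-> sat Nstd e A.
Proof.
  induction 1; intros e; cbn [sat];
    try (rewrite IHDelta0_1, IHDelta0_2; reflexivity);
    try (unfold_bounded; rewrite (R0_eval_nval M M_R0);
         apply (bounded_quantifiers_absolute M (eval Nstd e t)
           (fun d => sat M (env_cons d (fun n => nval M (e n))) A)
           (fun i => sat Nstd (env_cons i e) A));
         [intros d; apply R0_le_nval, M_R0
         |intros i _; apply R0_nval_eq, M_R0
         |intros i _; rewrite env_cons_nval; apply IHDelta0]).
  - rewrite !(R0_eval_nval M M_R0). apply R0_nval_eq, M_R0.
  - rewrite !(R0_eval_nval M M_R0). apply R0_nval_le, M_R0.
  - reflexivity.
Qed.

Lemma Nstd_R0 A : R0 A -> models Nstd A.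
Proof.
  intros [m n|m n|m n H|n|m n H] e; cbn [sat eval].
  1-2: rewrite !eval_num, !nval_Nstd; reflexivity.
  - unfold fNeg; cbn [sat]. rewrite !eval_num, !nval_Nstd. exact H.
  - intros d. rewrite eval_num, nval_Nstd, sat_eq_some_num_upto. intros H.
    exists d. rewrite nval_Nstd. auto.
  - rewrite !eval_num, !nval_Nstd. exact H.
Qed.

Lemma proves_sound T M A :
  (forall B, T B -> models M B) -> proves T A -> models M A.
Proof.
  intros HT (G & HG & H) e. eapply soundness; [exact H|].
  eapply Forall_impl; [|exact HG]. intros B HB. apply HT, HB.
Qed.

(** * Certified elements *)

(* [b] may be any number when [x] is not a numeral, and the least [b] denoting
   [x] otherwise. *)
Section Certified.

Variables (M : structure) (x : dom M) (e : nat -> dom M) (b : nat).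
Hypothesis x_cert : sat M (env_cons x e) cert.
Hypothesis b_min : forall i, i < b -> nval M i <> x.

Local Notation "0m" := (i_zero M).
Local Notation "s +m t" := (i_add M s t) (at level 50, left associativity).
Local Notation "s *m t" := (i_mul M s t) (at level 40, left associativity).
Local Notation "s <=m t" := (i_le M s t) (at level 70).

Lemma cert_below_closed : below_closed M x.
Proof. split; [apply x_cert|]. destruct x_cert as (_ & H & _). exact H. Qed.

Lemma cert_nval_le i : i <= b -> nval M i <=m x.
Proof.
  intros Hi. apply below_closed_le; [apply cert_below_closed|].
  intros j Hj. apply b_min. lia.
Qed.

(** Induction on [n] along the two clauses for the order. The successor clause speaks only of
    elements strictly below [x]; [b_min] makes the value of each number less than [b] such an
    element. *)
Lemma cert_le_nval n d :
  n <= b -> (d <=m nval M n <-> exists i, i <= n /\ d = nval M i).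
Proof.
  destruct x_cert as (_ & _ & H0 & HS & _). revert d.
  induction n as [|n IH]; intros d Hn.
  - destruct (H0 d) as [K1 K2]. cbn in K1, K2. split.
    + intros H. exists 0. split; [lia|]. apply K1, H.
    + intros (i & Hi & ->). apply K2.
      replace i with 0 by lia. reflexivity.
  - assert (Hlt : nval M n <=m x /\ nval M n <> x).
    { split; [apply cert_nval_le|apply b_min]; lia. }
    destruct (HS (nval M n) Hlt d) as [K1 K2]. cbn in K1, K2.
    rewrite IH in K1, K2 by lia. rewrite nval_S. split.
    + intros H. destruct (K1 H) as [(i & Hi & ->) | ->].
      * exists i. auto.
      * exists (S n). auto.
    + intros (i & Hi & ->). apply K2.
      destruct (Nat.eq_dec i (S n)) as [->|]; [right; reflexivity|].
      left. exists i. split; [lia|reflexivity].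
Qed.

(** The value of the product is a hypothesis because [cert_mul] calls on this lemma within its own
    induction. The range of [l] reaches [S b] since the successor clause for addition is applied at
    the predecessor of [l]. *)
Lemma cert_mul_add i j l :
  i <= b -> j <= b -> l <= S b ->
  nval M i *m nval M j = nval M (i * j) ->
  nval M i *m nval M j +m nval M l = nval M (i * j + l).
Proof.
  intros Hi Hj Hl E.
  destruct x_cert as (_ & _ & _ & _ & _ & _ & H0 & HS & _).
  induction l as [|l IH].
  - rewrite Nat.add_0_r, <- E.
    apply (H0 (nval M i) (cert_nval_le i Hi) (nval M j) (cert_nval_le j Hj)).
  - rewrite Nat.add_succ_r, !nval_S, <- IH by lia.
    apply (HS (nval M i) (cert_nval_le i Hi) (nval M j) (cert_nval_le j Hj)
      (nval M l)). cbn. apply cert_nval_le. lia.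
Qed.

Lemma cert_mul i j : i <= b -> j <= b -> nval M i *m nval M j = nval M (i * j).
Proof.
  intros Hi Hj. destruct x_cert as (_ & _ & _ & _ & _ & _ & _ & _ & H0 & HS).
  induction j as [|j IH].
  - rewrite Nat.mul_0_r. apply (H0 (nval M i) (cert_nval_le i Hi)).
  - assert (Hj' : j <= b) by lia.
    pose proof (HS (nval M i) (cert_nval_le i Hi)
      (nval M j) (cert_nval_le j Hj')) as K. cbn in K.
    rewrite nval_S, K, cert_mul_add by auto. f_equal. lia.
Qed.

(* The addition clauses only speak about sums whose left summand is a product;
   [0 * 0] avoids the use of [1] when [b = 0]. *)
Lemma cert_add i j : i <= b -> j <= b -> nval M i +m nval M j = nval M (i + j).
Proof.
  intros Hi Hj. destruct i as [|i].
  - change (nval M 0) with (nval M (0 * 0)). rewrite <- cert_mul by assumption.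
    rewrite cert_mul_add; auto. apply cert_mul; assumption.
  - replace (S i) with (S i * 1) at 1 by lia. rewrite <- cert_mul by lia.
    rewrite cert_mul_add; try lia; [f_equal; lia|]. apply cert_mul; lia.
Qed.

(* The values on which the certificate makes the successor injective. *)
Definition product_sum (m : nat) : Prop :=
  exists i j l, i <= b /\ j <= b /\ l <= b /\ m = i * j + l.

Lemma product_sum_pred m : product_sum (S m) -> product_sum m.
Proof.
  intros (i & j & [|l] & Hi & Hj & Hl & E).
  - destruct i as [|i]; [lia|]. destruct j as [|j]; [lia|].
    (* The predecessor of a nonzero product is reached by lowering the second factor by one and
       adding one less than the first factor. *)
    exists (S i), j, i. repeat split; lia.
  - exists i, j, l. repeat split; lia.
Qed.

Lemma product_sum_small m : m <= b -> product_sum m.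
Proof. intros H. exists 0, 0, m. repeat split; lia. Qed.

Lemma cert_succ_neq_zero m : product_sum m -> nval M (S m) <> 0m.
Proof.
  intros (i & j & l & Hi & Hj & Hl & ->).
  destruct x_cert as (_ & _ & _ & _ & H & _).
  pose proof (H (nval M i) (cert_nval_le i Hi) (nval M j) (cert_nval_le j Hj)
    (nval M l) (cert_nval_le l Hl)) as K. cbn in K.
  rewrite cert_mul_add in K; auto. apply cert_mul; assumption.
Qed.

Lemma cert_succ_inj m n :
  product_sum m -> n <= b -> nval M (S m) = nval M (S n) -> nval M m = nval M n.
Proof.
  intros (i & j & l & Hi & Hj & Hl & ->) Hn.
  destruct x_cert as (_ & _ & _ & _ & _ & H & _).
  pose proof (H (nval M i) (cert_nval_le i Hi) (nval M j) (cert_nval_le j Hj)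
    (nval M l) (cert_nval_le l Hl) (nval M n) (cert_nval_le n Hn)) as K. cbn in K.
  rewrite cert_mul_add in K; auto. apply cert_mul; assumption.
Qed.

(** Injectivity lowers both sides until one is zero, and [product_sum_pred] keeps the left side in
    range. Only [m] has to be a product sum: for [b = 0] and [m = 0], the number [S m] is not
    one. *)
Lemma cert_succ_eq n : forall m,
  product_sum m -> n <= b -> (nval M (S m) = nval M n <-> S m = n).
Proof.
  intros m Hm Hn. split; [|intros <-; reflexivity]. revert m Hm.
  induction n as [|n IH]; intros m Hm E.
  - destruct (cert_succ_neq_zero m Hm E).
  - f_equal. apply cert_succ_inj in E; [|exact Hm|lia].
    destruct m as [|m].
    + destruct n as [|n]; [reflexivity|].
      destruct (cert_succ_neq_zero n (product_sum_small n ltac:(lia))).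
      symmetry; exact E.
    + apply IH; [lia|apply product_sum_pred, Hm|exact E].
Qed.

(** The unequal ranges fit the atoms for sum and product: the left side may exceed [b], the right
    side is the value of a variable. *)
Lemma cert_nval_eq m n :
  product_sum m -> n <= b -> (nval M m = nval M n <-> m = n).
Proof.
  intros Hm Hn. destruct m as [|m].
  - split; [|intros <-; reflexivity]. intros E. destruct n as [|n]; [reflexivity|].
    destruct (cert_succ_neq_zero n (product_sum_small n ltac:(lia))).
    symmetry; exact E.
  - apply cert_succ_eq; [apply product_sum_pred, Hm|exact Hn].
Qed.

Lemma product_sum_add i j : i <= b -> j <= b -> product_sum (i + j).
Proof.
  intros Hi Hj. destruct i as [|i].
  - apply product_sum_small. exact Hj.
  - exists (S i), 1, j. repeat split; lia.
Qed.

Lemma product_sum_mul i j : i <= b -> j <= b -> product_sum (i * j).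
Proof. intros Hi Hj. exists i, j, 0. repeat split; lia. Qed.

Lemma env_cons_le i (f : nat -> nat) :
  i <= b -> (forall n, f n <= b) -> forall n, env_cons i f n <= b.
Proof. intros Hi Hf [|n]; simpl; auto. Qed.

Lemma shift_var_inv t j : tsubst shift t = tVar j -> exists i, t = tVar i.
Proof. destruct t; try discriminate. eauto. Qed.

(** Purity confines the evaluation to the range of the certificate: an atom applies at most one
    operation to values up to [b] and compares the result with such a value, and a bound, being a
    variable, keeps the quantified values up to [b]. *)
Lemma pure_Delta0_absolute A :
  Delta0 A -> pure_atoms A -> forall f : nat -> nat, (forall n, f n <= b) ->
  sat M (fun n => nval M (f n)) A <-> sat Nstd f A.
Proof.
  assert (Hle : forall m d, m <= b ->
    (d <=m nval M m <-> exists i, i <= m /\ d = nval M i)).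
  { intros m d Hm. apply cert_le_nval, Hm. }
  assert (Heq : forall m n, m <= b -> n <= b -> (nval M m = nval M n <-> m = n)).
  { intros m n Hm Hn. apply cert_nval_eq; auto using product_sum_small. }
  induction 1; intros HA f Hf; cbn [sat];
    try (rewrite IHDelta0_1, IHDelta0_2 by (assumption || apply HA); reflexivity);
    (* The order atom in the quantifier bound is itself pure, so the shifted bound is a variable,
       and hence so is [t]. *)
    try (assert (Ht : exists j, t = tVar j /\ pure_atoms A)
           by (cbn in HA; decompose [and ex] HA;
               match goal with E : tsubst shift _ = tVar _ |- _ =>
                 apply shift_var_inv in E as [j ->] end; eauto);
         destruct Ht as (j & -> & HA'); unfold_bounded; cbn [eval];
         apply (bounded_quantifiers_absolute M (f j)
           (fun d => sat M (env_cons d (fun n => nval M (f n))) A)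
           (fun i => sat Nstd (env_cons i f) A));
         [intros d; apply Hle, Hf
         |intros i Hi; apply Heq; [specialize (Hf j); lia|apply Hf]
         |intros i Hi; rewrite env_cons_nval; apply IHDelta0; [exact HA'|];
          apply env_cons_le; [specialize (Hf j); lia|exact Hf]]).
  - destruct HA as [i j|i|i j|i j k|i j k]; cbn [eval].
    + apply Heq; apply Hf.
    + apply (Heq 0); [lia|apply Hf].
    + apply cert_succ_eq; auto using product_sum_small.
    + rewrite cert_add by apply Hf. apply cert_nval_eq; auto using product_sum_add.
    + rewrite cert_mul by apply Hf. apply cert_nval_eq; auto using product_sum_mul.
  - destruct HA as (i & j & -> & ->). cbn [eval]. rewrite Hle by apply Hf. split.
    + intros (k & Hk & E). apply Heq in E; [cbn; lia|apply Hf|].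
      specialize (Hf j). lia.
    + intros H. exists (f i). auto.
  - reflexivity.
Qed.

End Certified.

(** As no numeral denotes [x], the number [b] of the preceding results may be chosen freely; for
    each axiom it is taken large enough to cover the numbers mentioned there. *)
Lemma cert_nonstandard_R0 M x e :
  sat M (env_cons x e) cert -> (forall i, nval M i <> x) ->
  forall A, R0 A -> models M A.
Proof.
  intros Hc Hx A [m n|m n|m n H|n|m n H] f; unfold fNeg; cbn [sat eval];
    rewrite ?eval_num.
  - apply (cert_add M x e (m + n)); auto; lia.
  - apply (cert_mul M x e (m + n)); auto; lia.
  - rewrite (cert_nval_eq M x e (m + n)); auto; [|lia].
    apply product_sum_small. lia.
  - intros d. rewrite eval_num, sat_eq_some_num_upto.
    apply (cert_le_nval M x e n); auto.
  - apply (cert_le_nval M x e n); eauto.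
Qed.

Lemma nval_least M x i :
  nval M i = x -> exists k, nval M k = x /\ forall j, j < k -> nval M j <> x.
Proof.
  induction i as [i IH] using lt_wf_ind. intros Hi.
  destruct (classic (exists j, j < i /\ nval M j = x)) as [(j & Hj & E)|H].
  - apply (IH j Hj E).
  - exists i. split; [exact Hi|]. intros j Hj E. apply H. eauto.
Qed.

(* Applied to the standard model when the certified element is a numeral, and
   to the given model otherwise, which is why one hypothesis on [tau] is enough. *)
Lemma certified_inconsistent rho rho0 tau :
  pure_form_of rho rho0 ->
  proves R0 (fIff rho tau) ->
  (forall M, (forall A, R0 A -> models M A) -> ~ sat M (fun _ => nval M 0) tau) ->
  inconsistent (certified rho0).
Proof.
  intros (((D & E & HD0 & HDp) & Hcl) & Hstd & Hval) Hprv Htau.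
  injection E as <-. unfold sentence in Hcl. cbn [free_below] in Hcl.
  apply NNPP. intros Hcon.
  destruct (model_existence _ Hcon) as (M & e & Hsat).
  apply Forall_inv in Hsat. destruct Hsat as (x & Hcert & Hrho0).
  destruct (classic (exists i, nval M i = x)) as [[i Hi]|Hx].
  - destruct (nval_least M x i Hi) as (k & Hk & Hmin).
    (* The environment constantly [k] keeps all parameters within the bound [k]. It agrees with the
       given one on variable 0, the only variable that may be free in [rho0]. *)
    assert (HN : sat Nstd (fun _ => k) rho0).
    { apply (pure_Delta0_absolute M x e k Hcert Hmin _ HD0 HDp); [auto|].
      eapply sat_agree; [exact Hcl| |exact Hrho0].
      intros [|n] Hn; [exact Hk|lia]. }
    apply (Htau Nstd Nstd_R0).
    apply (proves_sound _ _ _ Nstd_R0 Hprv), Hstd.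
    exists k. eapply sat_agree; [exact Hcl| |exact HN].
    intros [|n] Hn; [reflexivity|lia].
  - assert (HM : forall A, R0 A -> models M A).
    { apply cert_nonstandard_R0 with x e; [exact Hcert|].
      intros i Hi. apply Hx. eauto. }
    apply (Htau M HM).
    apply (proves_sound _ _ _ HM Hprv), Hval.
    exists x. eapply sat_agree; [exact Hcl| |exact Hrho0].
    intros [|n] Hn; [reflexivity|lia].
Qed.

(** * Witness comparison in models of R0 *)

Lemma sat_up_shift M d d' e A :
  sat M (env_cons d' (env_cons d e)) (fsubst (up shift) A)
  <-> sat M (env_cons d' e) A.
Proof.
  rewrite sat_subst.
  replace (fun n => eval M (env_cons d' (env_cons d e)) (up shift n))
    with (env_cons d' e); [reflexivity|].
  apply functional_extensionality; intros [|n]; reflexivity.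
Qed.

Lemma sat_wit_le M e A B :
  sat M e (wit_le A B) <->
  exists d, sat M (env_cons d e) A /\
    forall d', i_le M d' d -> d' <> d -> ~ sat M (env_cons d' e) B.
Proof.
  unfold wit_le, allLt, fLt, fNeg. cbn [sat]. setoid_rewrite sat_up_shift.
  cbn. firstorder.
Qed.

Lemma sat_wit_lt M e A B :
  sat M e (wit_lt A B) <->
  exists d, sat M (env_cons d e) A /\
    forall d', i_le M d' d -> ~ sat M (env_cons d' e) B.
Proof.
  unfold wit_lt, allLe, fNeg. cbn [sat]. setoid_rewrite sat_up_shift.
  cbn. firstorder.
Qed.

Lemma Delta0_absolute_at M (M_R0 : forall A, R0 A -> models M A) A n :
  Delta0 A ->
  sat M (env_cons (nval M n) (fun _ => nval M 0)) A
  <-> sat Nstd (env_cons n (fun _ => 0)) A.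
Proof.
  intros HA. rewrite <- (Delta0_absolute M M_R0 A HA).
  rewrite <- env_cons_nval. reflexivity.
Qed.

Theorem theorem6p4
  (sigma0 sigma0' rho rho0 : form)
  (Hsigma : one_Sigma1_sentence (fEx sigma0))
  (Hsigma' : one_Sigma1_sentence (fEx (fAnd wb sigma0')))
  (Hrho : Sigma1_sentence rho)
  (Hrho0 : pure_form_of rho rho0) :
  (models Nstd (wit_le sigma0 (fAnd wb sigma0')) ->
   proves R0 (fIff rho (wit_lt (fAnd wb sigma0') sigma0)) ->
   inconsistent (certified rho0))
  /\
  (models Nstd (wit_lt sigma0 (fAnd wb sigma0')) ->
   proves R0 (fIff rho (wit_le (fAnd wb sigma0') sigma0)) ->
   inconsistent (certified rho0)).
Proof.
  destruct Hsigma as [(D & E & Hs) _]. injection E as <-.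
  destruct Hsigma' as [(D' & E & Hs') _]. injection E as <-.
  split; intros HN Hprv; apply (certified_inconsistent _ _ _ Hrho0 Hprv);
    intros M HM H.
  - apply sat_wit_lt in H as (y & Hy & Hmin).
    destruct (proj1 (sat_wit_le _ _ _ _) (HN (fun _ => 0))) as (n & Hn & Hminn).
    (* The split is at [i < n] because [Hminn] excludes standard witnesses of the second sentence
       only strictly below [n]. Otherwise [n] is at or below [y], which is all that [Hmin]
       requires. *)
    destruct (classic (exists i, i < n /\ nval M i = y)) as [(i & Hi & <-)|Hlt].
    + apply (Hminn i); [cbn; lia|cbn; lia|].
      apply (Delta0_absolute_at M HM _ _ Hs'), Hy.
    + apply (Hmin (nval M n)).
      * apply below_closed_le; [apply Hy|]. intros i Hi E. apply Hlt. eauto.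
      * apply (Delta0_absolute_at M HM _ _ Hs), Hn.
  - apply sat_wit_le in H as (y & Hy & Hmin).
    destruct (proj1 (sat_wit_lt _ _ _ _) (HN (fun _ => 0))) as (n & Hn & Hminn).
    (* Now [Hminn] also covers the number [n] itself, so the split may be at [i <= n]; the second
       case then yields that [y] differs from [n], as [Hmin] only excludes witnesses strictly below
       [y]. *)
    destruct (classic (exists i, i <= n /\ nval M i = y)) as [(i & Hi & <-)|Hlt].
    + apply (Hminn i Hi). apply (Delta0_absolute_at M HM _ _ Hs'), Hy.
    + apply (Hmin (nval M n)).
      * apply below_closed_le; [apply Hy|].
        intros i Hi E. apply Hlt. exists i. split; [lia|exact E].
      * intros E. apply Hlt. eauto.
      * apply (Delta0_absolute_at M HM _ _ Hs), Hn.
Qed.
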